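(* Let $\mathbf{Q}[x]^{\mathsf{subs}}$ be the algebra with universe $\mathbb{Q}[x]$ and operations addition, multiplication and composition $(p,q)\mapsto p[x:=q]$. The functionality problem for bottom-up register automata with values in $\mathbf{Q}[x]^{\mathsf{subs}}$ (given such an automaton, decide whether it is functional) is undecidable, and the equivalence problem for functional bottom-up register automata with values in $\mathbf{Q}[x]^{\mathsf{subs}}$ (given two functional automata over the same input signature, decide whether they define the same partial function) is undecidable.
   Context: Polynomial functions. For an algebra with universe $A$, a polynomial function $A^k\to A$ is a function induced by a term built from variables, elements of $A$ as constants, and the operations of the algebra (here $+$, $\times$ and composition); a polynomial function $A^k\to A^m$ is an $m$-tuple of such functions. Register automata. A ranked signature $\Sigma$ is a finite set of symbols, each with a finite rank; ranked trees are terms over $\Sigma$. A bottom-up register automaton with values in an algebra with universe $A$ is a tuple $M=(\Sigma,n,Q,\delta,F)$ where $\Sigma$ is a ranked signature, $n$ is the number of registers, $Q$ is a finite set of states, $\delta$ is a finite set of rules $a(q_1,\dots,q_k)\to q,f$ with $a\in\Sigma$ of rank $k$, $q,q_1,\dots,q_k\in Q$, and $f:A^{n\times k}\to A^n$ a polynomial function, and $F$ is a partial function associating to some states $q$ a polynomial function $f_q:A^n\to A$. Inductively, $a(t_1,\dots,t_k)\to(q,f(\bar r_1,\dots,\bar r_k))$ whenever $a(q_1,\dots,q_k)\to q,f$ is in $\delta$ and $t_i\to(q_i,\bar r_i)$ for all $i$. The relation $[\![M]\!]$ relates a tree $t$ to each value $f_q(\bar r)$ such that $t\to(q,\bar r)$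 and $F(q)=f_q$ is defined. $M$ is functional if $[\![M]\!]$ is a (partial) function. *)

(* Defs.v *)
From Stdlib Require List.
From Stdlib Require Import FunctionalExtensionality.
From HB Require Import structures.
From mathcomp Require Import all_boot all_order all_algebra.

Set Implicit Arguments.
Unset Strict Implicit.
Unset Printing Implicit Defensive.

Import GRing.Theory.

Inductive recfun : nat -> Type :=
| RZero k : recfun k
| RSucc : recfun 1
| RProj k (i : 'I_k) : recfun k
| RComp m k (f : recfun m) (g : 'I_m -> recfun k) : recfun k
| RRec k (f : recfun k) (g : recfun k.+2) : recfun k.+1
| RMu k (f : recfun k.+1) : recfun k.

(** [computes f v y]: the partial function denoted by [f] is defined at [v],
    with value [y].  For [RRec], the recursion argument is the first one, and
    [h 0, ..., h (thead v)] are the successive values of the recursion. *)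
Fixpoint computes k (f : recfun k) : k.-tuple nat -> nat -> Prop :=
  match f in recfun k return k.-tuple nat -> nat -> Prop with
  | RZero _ => fun _ y => y = 0
  | RSucc => fun v y => y = (thead v).+1
  | RProj _ i => fun v y => y = tnth v i
  | RComp m _ f g => fun v y =>
      exists2 w : m.-tuple nat,
        forall i, computes (g i) v (tnth w i) & computes f w y
  | RRec _ f g => fun v y =>
      exists h : nat -> nat,
        [/\ computes f (behead_tuple v) (h 0),
            forall i, i < thead v ->
              computes g [tuple of i :: h i :: behead_tuple v] (h i.+1)
          & y = h (thead v)]
  | RMu _ f => fun v y =>
      computes f [tuple of y :: v] 0 /\
      forall i, i < y -> exists z, computes f [tuple of i :: v] z.+1
  end.

(** Decidability of a problem [P] on finitely presented instances [x : T],
    coded by natural numbers, under the promise that [promise x] holds: the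
    decision procedure answers 1 or 0 on the instances satisfying the promise,
    and its behaviour elsewhere (including termination) is unconstrained. *)
Definition decidable_promise (T : Type) (code : T -> nat)
    (promise P : T -> Prop) : Prop :=
  exists f : recfun 1, forall x, promise x ->
    (P x -> computes f [tuple code x] 1) /\
    (~ P x -> computes f [tuple code x] 0).

Definition decidable_problem (T : Type) (code : T -> nat) (P : T -> Prop) :=
  decidable_promise code (fun=> True) P.

Inductive pterm (V : Type) : Type :=
| PVar (v : V)
| PConst (p : {poly rat})
| PAdd (s t : pterm V)
| PMul (s t : pterm V)
| PSubs (s t : pterm V).

Arguments PConst {V} p.

Fixpoint peval V (rho : V -> {poly rat}) (t : pterm V) : {poly rat} :=
  match t with
  | PVar v => rho v
  | PConst p => p
  | PAdd s t => (peval rho s + peval rho t)%R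
  | PMul s t => (peval rho s * peval rho t)%R
  | PSubs s t => (peval rho s \Po peval rho t)%R
  end.

(** The list of the ranks of the symbols; the symbols are the positions. *)
Definition signature := seq nat.

Definition symbol (S : signature) := 'I_(size S).

Definition rank (S : signature) (a : symbol S) : nat := nth 0 S a.

Inductive tree (S : signature) : Type :=
| Node (a : symbol S) (ts : 'I_(rank a) -> tree S).

(** A rule [a(q_1, ..., q_k) -> q, f] for a symbol [a] of rank [k], with
    [nreg] registers and [nst] states.  The polynomial function
    [f : A^(nreg x k) -> A^nreg] is given by terms; the variable [(i, j)]
    stands for register [i] of the [j]-th subtree. *)
Record rule (nreg nst k : nat) := Rule {
  rule_src : k.-tuple 'I_nst;
  rule_tgt : 'I_nst;
  rule_upd : nreg.-tuple (pterm ('I_nreg * 'I_k)) }.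

(** The finite set of rules is presented symbol by symbol. *)
Record automaton (S : signature) := Automaton {
  nreg : nat;
  nst : nat;
  delta : forall a : symbol S, seq (rule nreg nst (rank a));
  out : nst.-tuple (option (pterm 'I_nreg)) }.

Fixpoint run S (M : automaton S) (t : tree S) :
    'I_(nst M) -> {ffun 'I_(nreg M) -> {poly rat}} -> Prop :=
  match t with
  | Node a ts => fun q v =>
      exists r : rule (nreg M) (nst M) (rank a),
      exists vs : 'I_(rank a) -> {ffun 'I_(nreg M) -> {poly rat}},
        [/\ List.In r (delta M a),
            forall j, run (ts j) (tnth (rule_src r) j) (vs j),
            q = rule_tgt r
          & v = [ffun i => peval (fun ij => vs ij.2 ij.1)
                                 (tnth (rule_upd r) i)]]
  end.

Definition semantics S (M : automaton S) (t : tree S) (p : {poly rat}) :=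
  exists q v f,
    [/\ run t q v, tnth (out M) q = Some f & p = peval v f].

Definition functional S (M : automaton S) : Prop :=
  forall t p1 p2, semantics M t p1 -> semantics M t p2 -> p1 = p2.

(** For functional automata: the two partial functions coincide, domains
    included. *)
Definition equivalent S (M N : automaton S) : Prop :=
  forall t p, semantics M t p <-> semantics N t p.

(** [CodeSeq.code] is a computable bijection from [seq nat] to [nat]. *)
Notation code_seq := CodeSeq.code.

Definition code_int (z : int) : nat :=
  match z with Posz n => code_seq [:: 0; n] | Negz n => code_seq [:: 1; n] end.

Definition code_rat (r : rat) : nat :=
  code_seq [:: code_int (numq r); code_int (denq r)].

Definition code_poly (p : {poly rat}) : nat := code_seq (map code_rat p).

Fixpoint code_pterm V (code_var : V -> nat) (t : pterm V) : nat :=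
  match t with
  | PVar v => code_seq [:: 0; code_var v]
  | PConst p => code_seq [:: 1; code_poly p]
  | PAdd s t => code_seq [:: 2; code_pterm code_var s; code_pterm code_var t]
  | PMul s t => code_seq [:: 3; code_pterm code_var s; code_pterm code_var t]
  | PSubs s t => code_seq [:: 4; code_pterm code_var s; code_pterm code_var t]
  end.

Definition code_ord n (i : 'I_n) : nat := i.

Definition code_ord2 n k (ij : 'I_n * 'I_k) : nat :=
  code_seq [:: nat_of_ord ij.1; nat_of_ord ij.2].

Definition code_rule n m k (r : rule n m k) : nat :=
  code_seq [:: code_seq (map (@code_ord m) (rule_src r));
               code_ord (rule_tgt r);
               code_seq (map (code_pterm (@code_ord2 n k)) (rule_upd r))].

Definition code_out n (f : option (pterm 'I_n)) : nat :=
  if f is Some t then (code_pterm (@code_ord n) t).+1 else 0.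

Definition code_automaton S (M : automaton S) : nat :=
  code_seq [:: nreg M; nst M;
               code_seq [seq code_seq (map (@code_rule _ _ _) (delta M a))
                        | a <- enum 'I_(size S)];
               code_seq (map (@code_out _) (out M))].

Definition code_instance (X : {S : signature & automaton S}) : nat :=
  code_seq [:: code_seq (tag X); code_automaton (tagged X)].

Definition code_pair_instance
    (X : {S : signature & (automaton S * automaton S)%type}) : nat :=
  code_seq [:: code_seq (tag X); code_automaton (tagged X).1;
               code_automaton (tagged X).2].

Lemma code_seq_inj : injective code_seq.
Proof. exact: can_inj CodeSeq.codeK. Qed.

Lemma code_int_inj : injective code_int.
Proof. by move=> [m|m] [n|n] /code_seq_inj // [] ->. Qed.

Lemma code_rat_inj : injective code_rat.
Proof.
move=> r s /code_seq_inj[/code_int_inj en /code_int_inj ed].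
by have := divq_num_den r; rewrite en ed divq_num_den.
Qed.

Lemma code_poly_inj : injective code_poly.
Proof.
by move=> p q /code_seq_inj /(inj_map code_rat_inj) /val_inj.
Qed.

Lemma code_pterm_inj V (cv : V -> nat) :
  injective cv -> injective (code_pterm cv).
Proof.
move=> cv_inj; elim=> [v|p|s IHs t IHt|s IHs t IHt|s IHs t IHt]
  [w|q|s' t'|s' t'|s' t'] /code_seq_inj // [].
- by move=> /cv_inj ->.
- by move=> /code_poly_inj ->.
- by move=> /IHs -> /IHt ->.
- by move=> /IHs -> /IHt ->.
- by move=> /IHs -> /IHt ->.
Qed.

Lemma code_ord_inj n : injective (@code_ord n).
Proof. exact: val_inj. Qed.

Lemma code_ord2_inj n k : injective (@code_ord2 n k).
Proof.
by move=> [i j] [i' j'] /code_seq_inj /= -[/val_inj -> /val_inj ->].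
Qed.

Lemma code_rule_inj n m k : injective (@code_rule n m k).
Proof.
move=> [s q u] [s' q' u'] /code_seq_inj /= [].
move=> /code_seq_inj /(inj_map (@code_ord_inj _)) /val_inj ->.
move=> /code_ord_inj ->.
by move=> /code_seq_inj
  /(inj_map (code_pterm_inj (@code_ord2_inj _ _))) /val_inj ->.
Qed.

Lemma code_out_inj n : injective (@code_out n).
Proof.
by move=> [s|] [t|] //= [] /(code_pterm_inj (@code_ord_inj n)) ->.
Qed.

Lemma code_automaton_inj S : injective (@code_automaton S).
Proof.
move=> [n m d o] [n' m' d' o'] /code_seq_inj /= [] En Em.
case: n' / En d' o' => d' o'; case: m' / Em d' o' => d' o'.
move=> /code_seq_inj Ed /code_seq_inj
  /(inj_map (@code_out_inj _)) /val_inj ->.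
suff -> : d = d' by [].
apply: functional_extensionality_dep => a.
move/eq_in_map: Ed => /(_ a); rewrite mem_enum => /(_ isT).
by move=> /code_seq_inj /(inj_map (@code_rule_inj _ _ _)).
Qed.

Lemma code_instance_inj : injective code_instance.
Proof.
move=> [S M] [S' M'] /code_seq_inj /= [] /code_seq_inj ES.
by case: S' / ES M' => M' /code_automaton_inj ->.
Qed.

Lemma code_pair_instance_inj : injective code_pair_instance.
Proof.
move=> [S [M N]] [S' [M' N']] /code_seq_inj /= [] /code_seq_inj ES.
by case: S' / ES M' N' => M' N' /code_automaton_inj -> /code_automaton_inj ->.
Qed.

(* Main.v *)
Require Import Defs.
From mathcomp Require Import all_boot all_order all_algebra.

Set Implicit Arguments.
Unset Strict Implicit.
Unset Printing Implicit Defensive.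

Import GRing.Theory Num.Theory.

(* A derivation witnessing that a partial recursive function has value [y] at
   [v] is a tree, with numbers at its nodes and equalities between the numbers
   of a node and of its children as side conditions.  An automaton reads such
   trees with the numbers in its registers.  It also stores a polynomial [p]
   that vanishes at [1], ..., [N] but not at [0], where [N] bounds all the
   numbers seen, so that [a = b] iff [p(a - b) p(b - a)] is non zero, and the
   product of these tests: the output is non zero iff the derivation is valid.

   Adding a rule with output [0] yields an automaton which is functional iff
   there is no valid derivation, and this also holds for equivalence with an
   automaton of the same domain and output [0].  Applied to the function that
   runs a putative decision procedure on the code of the automaton itself, this
   is a contradiction; the automaton gets hold of its own code by having a list
   [p] of constants in one rule, its code being computable from [p] and from
   the codes of its other parts, which are the values given to [p]. *)

(** * Recursive functions *)

Lemma computes_inj k (f : recfun k) v y z :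
  computes f v y -> computes f v z -> y = z.
Proof.
elim: f v y z => [{}k|||m {}k f IHf g IHg|{}k f IHf g IHg|{}k f IHf] /=.
- by move=> v y z -> ->.
- by move=> v y z -> ->.
- by move=> ? i v y z -> ->.
- move=> v y z [w gw fw] [w' gw' fw'].
  suff Ew : w = w' by rewrite -Ew in fw'; apply: IHf fw fw'.
  by apply: eq_from_tnth => i; apply: IHg (gw i) (gw' i).
- move=> v y z [h [h0 hS ->]] [h' [h0' hS' ->]].
  have: thead v <= thead v by [].
  elim: {1 3 4}(thead v) => [_|i IHi lt_i]; first exact: IHf h0 h0'.
  have Ei := IHi (ltnW lt_i).
  by apply: IHg (hS _ lt_i) _; rewrite Ei; apply: hS'.
(* If [y] and [z] differed, [f] would be both zero and positive at the smaller one. *)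
- move=> v y z [fy lty] [fz ltz]; case: (ltngtP y z) => // [/ltz|/lty] [u fu].
    by have := IHf _ _ _ fy fu.
  by have := IHf _ _ _ fz fu.
Qed.

Definition computable k (F : k.-tuple nat -> nat) : Prop :=
  exists f : recfun k, forall v, computes f v (F v).

Lemma computable_proj k (i : 'I_k) : computable (fun v => tnth v i).
Proof. by exists (RProj i). Qed.

Lemma computable_comp k m (F : m.-tuple nat -> nat)
    (G : 'I_m -> k.-tuple nat -> nat) :
  computable F -> (forall i, computable (G i)) ->
  computable (fun v => F [tuple G i v | i < m]).
Proof.
move=> [f fP] /fin_all_exists [g gP]; exists (RComp f g) => v.
by exists [tuple G i v | i < m] => // i; rewrite tnth_mktuple.
Qed.

Lemma computable_succ k (F : k.-tuple nat -> nat) :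
  computable F -> computable (fun v => (F v).+1).
Proof.
move=> cF.
have cS : computable (fun v : 1.-tuple nat => (thead v).+1) by exists RSucc.
have [f fP] := computable_comp cS (fun _ : 'I_1 => cF).
by exists f => v; move: (fP v); rewrite /thead tnth_mktuple.
Qed.

Lemma computable_const k n : computable (fun _ : k.-tuple nat => n).
Proof.
by elim: n => [|n IHn]; [exists (RZero k) | apply: computable_succ].
Qed.

Lemma computable_iter k (s : nat -> nat) (F G : k.-tuple nat -> nat) :
  computable (fun v : 1.-tuple nat => s (thead v)) ->
  computable F -> computable G ->
  computable (fun v => iter (F v) s (G v)).
Proof.
move=> [fs fsP] [f fP] [g gP].
(* Position 1 of [i :: h i :: v] is the previous value; the counter [i] is ignored. *)
pose step : recfun k.+2 := RComp fs (fun _ => RProj (lift ord0 ord0)).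
exists (RComp (RRec g step)
         (fun i => if unlift ord0 i is Some j then RProj j else f)) => v.
exists [tuple of F v :: v] => [i|].
  by case: unliftP => [j|] ->; rewrite ?tnthS ?tnth0 //=.
exists (fun i => iter i s (G v)); split=> [|i _|//].
  suff -> : behead_tuple [tuple of F v :: v] = v by [].
  exact: val_inj.
exists [tuple iter i s (G v)] => [j|].
  by rewrite (ord1 j) /= tnthS !tnth0.
by have := fsP [tuple iter i s (G v)]; rewrite theadE.
Qed.

Lemma computable_code_nil k : computable (fun _ : k.-tuple nat => code_seq [::]).
Proof. exact: computable_const. Qed.

(** [code_seq (n :: s)] is [2 ^ n * (code_seq s).*2.+1]: doubling iterated [n] times, where doubling
    is itself an iteration of adding 2. *)
Lemma computable_code_cons k (F : k.-tuple nat -> nat) (s : k.-tuple nat -> seq nat) :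
  computable F -> computable (fun v => code_seq (s v)) ->
  computable (fun v => code_seq (F v :: s v)).
Proof.
move=> cF cs.
have iter2 n : iter n (fun m => m.+2) 0 = n.*2 by elim: n => //= n ->.
have iterD n m : iter n double m = 2 ^ n * m.
  by elim: n => [|n IHn]; rewrite ?mul1n // iterS IHn expnS -mulnA mul2n.
have cdbl : computable (fun v : 1.-tuple nat => (thead v).*2).
  have [f fP] := computable_iter (s := fun n => n.+2)
    (computable_succ (computable_succ (computable_proj ord0)))
    (computable_proj ord0) (computable_const 1 0).
  by exists f => v; have := fP v; rewrite iter2.
have c2s : computable (fun v => (code_seq (s v)).*2.+1).
  apply: computable_succ.
  have [f fP] := computable_comp cdbl (fun _ : 'I_1 => cs).
  by exists f => v; have := fP v; rewrite /thead tnth_mktuple.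
have [f fP] := computable_iter cdbl cF c2s.
by exists f => v; have := fP v; rewrite iterD.
Qed.

(** * Derivations with guarded clauses *)

(* [(Some (i, j), c)] stands for register [i] of the [j]-th child plus [c],
   and [(None, c)] for the constant [c]. *)
Definition expr : eqType := (option (nat * nat) * nat)%type.

Definition eval (vs : seq (seq nat)) (e : expr) : nat :=
  (if e.1 is Some ij then nth 0 (nth [::] vs ij.2) ij.1 else 0) + e.2.

Definition reg i j : expr := (Some (i, j), 0).
Definition cst c : expr := (None, c).

Definition clause (T : eqType) : eqType :=
  (seq T * seq (expr * expr) * seq expr)%type.

Definition src T (r : clause T) : seq T := r.1.1.
Definition guards T (r : clause T) : seq (expr * expr) := r.1.2.
Definition upd T (r : clause T) : seq expr := r.2.

Definition holds (vs : seq (seq nat)) (gs : seq (expr * expr)) : bool :=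
  all (fun g => eval vs g.1 == eval vs g.2) gs.

(** The premise on the children is indexed by positions, so that the generated induction principle
    has hypotheses for them; [derives_all] is the form for explicit lists. *)
Inductive derives (T : eqType) (rl : T -> seq (clause T)) :
  T -> seq nat -> Prop :=
| Derives q r vs of r \in rl q & size vs = size (src r)
    & (forall j, j < size (src r) ->
         derives rl (nth q (src r) j) (nth [::] vs j))
    & holds vs (guards r) :
    derives rl q (map (eval vs) (upd r)).

Fixpoint derives_all (T : eqType) (rl : T -> seq (clause T)) qs vs : Prop :=
  match qs, vs with
  | [::], [::] => True
  | q :: qs, v :: vs => derives rl q v /\ derives_all rl qs vs
  | _, _ => False
  end.

Lemma derives_allP (T : eqType) (rl : T -> seq (clause T)) q0 qs vs :
  derives_all rl qs vs <->
  size vs = size qs /\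
  forall j, j < size qs -> derives rl (nth q0 qs j) (nth [::] vs j).
Proof.
elim: qs vs => [|q qs IHqs] [|v vs] /=; try by split=> // -[].
rewrite IHqs; split=> [[qv [-> qvs]]|[[->] qvs]].
  by split=> // -[|j] //; apply: qvs.
by split; [apply: (qvs 0) | split=> // j; apply: (qvs j.+1)].
Qed.

Lemma derivesE (T : eqType) (rl : T -> seq (clause T)) q v :
  derives rl q v <->
  exists r vs, [/\ r \in rl q, derives_all rl (src r) vs,
                   holds vs (guards r) & v = map (eval vs) (upd r)].
Proof.
split=> [[{}q r vs qr szvs qvs hvs]|[r [vs [qr /(derives_allP _ q)[? ?] ? ->]]]].
  by exists r, vs; split=> //; apply/(derives_allP _ q).
exact: Derives.
Qed.

Lemma derivesI (T : eqType) (rl : T -> seq (clause T)) q v vs r :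
  r \in rl q -> derives_all rl (src r) vs -> holds vs (guards r) ->
  v = map (eval vs) (upd r) -> derives rl q v.
Proof. by move=> *; apply/derivesE; exists r, vs. Qed.

Definition clause_map (T U : eqType) (h : T -> U) (r : clause T) : clause U :=
  (map h (src r), guards r, upd r).

(** [clause_map] keeps guards and updates, and the clauses of [h q] only lead to states in the image
    of [h], so that derivations correspond node by node. *)
Lemma derives_map (T U : eqType) (rlT : T -> seq (clause T))
    (rlU : U -> seq (clause U)) (h : T -> U) q v :
  (forall q, rlU (h q) =i map (clause_map h) (rlT q)) ->
  derives rlU (h q) v <-> derives rlT q v.
Proof.
move=> rlE; split; last first.
  elim=> {q v} q r vs qr szvs _ IH hvs.
  apply: (@Derives _ _ _ (clause_map h r)) => //.
  - by rewrite rlE map_f.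
  - by rewrite size_map.
  - by move=> j; rewrite size_map => lt_j; rewrite (nth_map q) //; apply: IH.
move Eq': (h q) => q' Dq'; elim: Dq' q Eq' => {q' v} q' r' vs.
move=> q'r' szvs _ IH hvs q Eq'; subst q'.
move: q'r' szvs IH hvs; rewrite rlE => /mapP[r qr ->]; rewrite size_map => szvs IH hvs.
apply: Derives => // j lt_j; apply: IH; rewrite ?size_map //.
by rewrite (nth_map q).
Qed.

(** * Compiling recursive functions into systems of clauses *)

Record system := System {
  state : finType;
  clauses : state -> seq (clause state);
  start : state }.

(** A derivation takes no input: its leaves guess the arguments, and the start state enumerates the
    whole graph of [f], with the result in front. *)
Definition realizes (s : system) k (f : recfun k) : Prop :=
  forall v, derives (@clauses s) (start s) v <->
  exists (w : k.-tuple nat) y, v = y :: w /\ computes f w y.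

Section Glue.

Variables (I : finType) (F : I -> system).

(** The systems [F i] serve as subroutines. Of the three new states, [Main] is the start, [Numeral]
    guesses an arbitrary number, and [Aux] is given clauses by [mu_system] only. *)
Definition glue_state : finType := (option bool + {i : I & state (F i)})%type.

Definition Main : glue_state := inl None.
Definition Aux : glue_state := inl (Some true).
Definition Numeral : glue_state := inl (Some false).
Definition Sub i (q : state (F i)) : glue_state :=
  inr (Tagged (fun i => state (F i)) q).
Definition Call i : glue_state := Sub (start (F i)).

Variables main aux : seq (clause glue_state).

Definition glue_clauses (q : glue_state) : seq (clause glue_state) :=
  match q with
  | inl None => main
  | inl (Some true) => aux
  | inl (Some false) =>
      [:: ([::], [::], [:: cst 0]);
          ([:: Numeral], [::], [:: (Some (0, 0), 1)])]
  | inr (existT i q) => map (clause_map (@Sub i)) (clauses q)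
  end.

Definition glue : system := @System glue_state glue_clauses Main.

Lemma derives_Call k (f : recfun k) i v : realizes (F i) f ->
  derives glue_clauses (Call i) v <->
  exists (w : k.-tuple nat) y, v = y :: w /\ computes f w y.
Proof. by move=> <-; apply: (derives_map (h := @Sub i)). Qed.

Lemma derives_Num v :
  derives glue_clauses Numeral v <-> exists a, v = [:: a].
Proof.
split=> [/derivesE[r [vs []]]|[a ->]].
  rewrite !inE => /orP[]/eqP-> /= _ _ ->; [by exists 0|].
  by eexists.
elim: a => [|a IHa]; apply/derivesE.
  by exists ([::], [::], [:: cst 0]), [::]; rewrite inE eqxx.
exists ([:: Numeral], [::], [:: (Some (0, 0), 1)]), [:: [:: a]].
by rewrite !inE eqxx orbT /= /eval /= addn1.
Qed.

(** [regs] copies a tuple held by one child, whereas [nums] gathers a tuple guessed by [k] numeral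
    children. *)
Definition regs k a j : seq expr := [seq reg (a + l) j | l <- iota 0 k].
Definition nums k : seq expr := [seq reg 0 l | l <- iota 0 k].

Lemma eval_regs vs k a j : size (nth [::] vs j) = a + k ->
  map (eval vs) (regs k a j) = drop a (nth [::] vs j).
Proof.
move=> szv; apply: (@eq_from_nth _ 0) => [|l].
  by rewrite !size_map size_iota size_drop szv addKn.
rewrite !size_map size_iota => lt_l.
rewrite -map_comp (nth_map 0) ?size_iota // nth_iota // add0n.
by rewrite nth_drop /eval /= addn0.
Qed.

Lemma holds_zip vs s t : size s = size t ->
  holds vs (zip s t) = (map (eval vs) s == map (eval vs) t).
Proof.
elim: s t => [|e s IHs] [|e' t] //= [szst].
by rewrite /holds /= eqseq_cons -IHs.
Qed.

Lemma derives_nums k (vs : seq (seq nat)) :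
  (forall j, j < k -> derives glue_clauses Numeral (nth [::] vs j)) <->
  exists w : k.-tuple nat, forall j, j < k -> nth [::] vs j = [:: nth 0 w j].
Proof.
split=> [numvs|[w Ew] j lt_j]; last first.
  by rewrite Ew //; apply/derives_Num; eexists.
exists [tuple nth 0 (nth [::] vs j) 0 | j < k] => j lt_j.
have /derives_Num[a Ea] := numvs j lt_j.
by rewrite -[j]/(val (Ordinal lt_j)) -tnth_nth tnth_mktuple /= Ea.
Qed.

Lemma eval_nums vs k (w : k.-tuple nat) :
  (forall j, j < k -> nth [::] vs j = [:: nth 0 w j]) ->
  map (eval vs) (nums k) = w.
Proof.
move=> Ew; apply: (@eq_from_nth _ 0) => [|l].
  by rewrite !size_map size_iota size_tuple.
rewrite !size_map size_iota => lt_l.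
rewrite -map_comp (nth_map 0) ?size_iota // nth_iota // add0n.
by rewrite /eval /= addn0 Ew.
Qed.

End Glue.

Definition no_system (i : void) : system := match i with end.

Definition leaf_system k (e : expr) : system :=
  @glue _ no_system [:: (nseq k (Numeral no_system), [::], e :: nums k)] [::].

Definition comp_family m (sf : system) (sg : 'I_m -> system) o : system :=
  if o is Some i then sg i else sf.

(** The children are [k] numerals, the [m] inner calls and the outer call. The guards equate the
    arguments of each inner call with the numerals, and the inner results with the outer arguments.
    The numerals supply the arguments even when [m = 0]. *)
Definition comp_system m k (sf : system) (sg : 'I_m -> system) : system :=
  let F := comp_family sf sg in
  @glue (option 'I_m) F
    [:: (nseq k (Numeral F) ++ [seq Call F (Some i) | i <- enum 'I_m] ++ [:: Call F None],
         flatten [seq zip (regs k 1 (k + i)) (nums k) | i <- iota 0 m] ++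
           zip [seq reg 0 (k + i) | i <- iota 0 m] (regs m 1 (k + m)),
         reg 0 (k + m) :: nums k)]
    [::].

Definition rec_family (sf sg : system) (b : bool) : system :=
  if b then sg else sf.

(** The first clause turns [y :: w], from [f], into [y :: 0 :: w]. The second one combines
    [h :: i :: w], from [Main] itself, and [y :: i :: h :: w], from [g], into [y :: i.+1 :: w]. *)
Definition rec_system k (sf sg : system) : system :=
  let F := rec_family sf sg in
  @glue bool F
    [:: ([:: Call F false], [::], reg 0 0 :: cst 0 :: regs k 1 0);
        ([:: Main F; Call F true],
         (reg 1 0, reg 1 1) :: (reg 0 0, reg 2 1) :: zip (regs k 2 0) (regs k 3 1),
         reg 0 1 :: (Some (1, 0), 1) :: regs k 2 0)]
    [::].

Definition mu_family (sf : system) (_ : unit) : system := sf.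

(* The auxiliary state derives [y :: v] when [f (i, v)] is defined and positive
   for every [i < y]. *)
Definition mu_system k (sf : system) : system :=
  let F := mu_family sf in
  @glue unit F
    [:: ([:: Aux F; Call F tt],
         (reg 0 0, reg 1 1) :: (reg 0 1, cst 0) :: zip (regs k 1 0) (regs k 2 1),
         reg 0 0 :: regs k 1 0)]
    [:: (nseq k (Numeral F), [::], cst 0 :: nums k);
        ([:: Aux F; Call F tt; Numeral F],
         (reg 0 0, reg 1 1) :: (reg 0 1, (Some (0, 2), 1)) ::
           zip (regs k 1 0) (regs k 2 1),
         (Some (0, 0), 1) :: regs k 1 0)].

Fixpoint compile k (f : recfun k) : system :=
  match f with
  | RZero k => leaf_system k (cst 0)
  | RSucc => leaf_system 1 (Some (0, 0), 1)
  | RProj k i => leaf_system k (reg 0 i)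
  | RComp m k f g => comp_system k (compile f) (fun i => compile (g i))
  | RRec k f g => rec_system k (compile f) (compile g)
  | RMu k f => mu_system k (compile f)
  end.

Lemma size_regs k a j : size (regs k a j) = k.
Proof. by rewrite size_map size_iota. Qed.

Lemma size_nums k : size (nums k) = k.
Proof. by rewrite size_map size_iota. Qed.

Lemma leaf_systemP k (f : recfun k) e (y : k.-tuple nat -> nat) :
  (forall (w : k.-tuple nat) vs, (forall j, j < k -> nth [::] vs j = [:: nth 0 w j]) ->
     eval vs e = y w) ->
  (forall w z, computes f w z <-> z = y w) ->
  realizes (leaf_system k e) f.
Proof.
move=> ey fy v; rewrite derivesE; split=> [[r [vs []]]|[w [z [-> /fy->]]]].
  rewrite inE => /eqP-> /= /(derives_allP _ (Numeral no_system))[szvs qvs] _ ->.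
  rewrite size_nseq in szvs qvs.
  have /derives_nums[w Ew]: forall j, j < k ->
      derives (glue_clauses [:: (nseq k (Numeral no_system), [::], e :: nums k)] [::])
        (Numeral no_system) (nth [::] vs j).
    by move=> j lt_j; have := qvs j lt_j; rewrite nth_nseq lt_j.
  by exists w, (y w); rewrite (ey w) // (eval_nums Ew); split=> //; apply/fy.
pose vs := [seq [:: a] | a <- w].
have Ew j : j < k -> nth [::] vs j = [:: nth 0 w j].
  by move=> lt_j; rewrite (nth_map 0) ?size_tuple.
exists (nseq k (Numeral no_system), [::], e :: nums k), vs; split=> //=.
- by rewrite inE.
- apply/(derives_allP _ (Numeral no_system)); rewrite size_nseq size_map size_tuple.
  split=> // j lt_j; rewrite nth_nseq lt_j; move: j lt_j.
  by apply/derives_nums; exists w.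
by rewrite (ey w) // (eval_nums Ew).
Qed.

Arguments computes : simpl never.

Lemma computes_val k (f : recfun k) (v w : k.-tuple nat) y :
  computes f v y -> v = w :> seq nat -> computes f w y.
Proof. by move=> fv /val_inj <-. Qed.

Lemma computes_RRec k (f : recfun k) g (w : k.-tuple nat) i y :
  computes (RRec f g) [tuple of i :: w] y <->
  exists h : nat -> nat,
    [/\ computes f w (h 0),
        forall j, j < i -> computes g [tuple of [:: j, h j & w]] (h j.+1)
      & y = h i].
Proof.
split=> -[h [h0 hS]]; rewrite ?theadE => ->; exists h; split.
- exact: computes_val h0 _.
- by move=> j lt_j; apply: computes_val (hS j _) _; rewrite ?theadE.
- by [].
- exact: computes_val h0 _.
- by rewrite theadE => j lt_j; apply: computes_val (hS j lt_j) _.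
- by rewrite theadE.
Qed.

Lemma computes_RRec0 k (f : recfun k) g (w : k.-tuple nat) y :
  computes (RRec f g) [tuple of 0 :: w] y <-> computes f w y.
Proof.
rewrite computes_RRec; split=> [[h [h0 _ ->]]|fy] //.
by exists (fun=> y).
Qed.

(** Trades the history function for a single step of recursion, in the form of the second clause of
    [rec_system]. *)
Lemma computes_RRecS k (f : recfun k) g (w : k.-tuple nat) i y :
  computes (RRec f g) [tuple of i.+1 :: w] y <->
  exists h, computes (RRec f g) [tuple of i :: w] h /\
            computes g [tuple of [:: i, h & w]] y.
Proof.
rewrite computes_RRec; split=> [[h [h0 hS ->]]|[z []]].
  exists (h i); split; last exact: hS.
  by apply/computes_RRec; exists h; split=> // j /ltnW; apply: hS.
move=> /computes_RRec[h [h0 hS ->]] gy.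
exists (fun j => if j <= i then h j else y); rewrite ltnn; split=> // j.
rewrite ltnS; case: (ltngtP j i) => // [lt_j _|-> _ //].
exact: hS.
Qed.

Lemma rec_systemP k (f : recfun k) (g : recfun k.+2) sf sg :
  realizes sf f -> realizes sg g -> realizes (rec_system k sf sg) (RRec f g).
Proof.
move=> sfP sgP v.
have callf := @derives_Call _ (rec_family sf sg) _ _ _ f false _ sfP.
have callg := @derives_Call _ (rec_family sf sg) _ _ _ g true _ sgP.
split.
  move Eq: (start _) => q Dq.
  elim: Dq Eq => {q v} q r vs qr szvs qvs IH hvs Eq; subst q.
  move: qr; rewrite !inE => /orP[]/eqP Er; subst r.
    case: vs szvs qvs {IH hvs} => [|v []] //= _ /(_ 0 isT) /=.
    move=> /callf[w [y [-> fy]]].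
    exists [tuple of 0 :: w], y; rewrite eval_regs /= ?size_tuple // drop0.
    by rewrite /eval /= addn0; split=> //; apply/computes_RRec0.
  case: vs szvs qvs IH hvs => [|v [|v' []]] //= _ qvs IH hvs.
  have [w [y [/= Ev fy]]] := IH 0 isT erefl; subst v.
  have /= /callg[w' [z [Ev' gz]]] := qvs 1 isT; subst v'.
  move: w w' fy gz hvs {IH qvs}.
  case/tupleP=> i w; case/tupleP=> i' /tupleP[h w'].
  rewrite /holds /= -/(holds _ _) holds_zip ?size_regs //.
  rewrite !eval_regs /= ?size_tuple // !drop0 /eval /= !addn0.
  move=> fy gz /and3P[/eqP Ei /eqP Eh /eqP/val_inj Ew]; subst.
  exists [tuple of i'.+1 :: w'], z; rewrite addn1; split=> //.
  by apply/computes_RRecS; exists h.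
case=> w [y [-> {v}]]; case/tupleP: w => i w.
elim: i y => [|i IHi] y.
  move=> /computes_RRec0 fy.
  apply: (derivesI (vs := [:: y :: w])
    (r := ([:: Call _ false], [::], reg 0 0 :: cst 0 :: regs k 1 0))) => //=.
  - by rewrite inE eqxx.
  - by split=> //; apply/callf; exists w, y.
  by rewrite eval_regs /= ?size_tuple // drop0 /eval /= addn0.
move=> /computes_RRecS[h [/IHi fh gy]].
apply: (derivesI (vs := [:: [:: h, i & w]; [:: y, i, h & w]])
  (r := ([:: Main _; Call _ true],
        (reg 1 0, reg 1 1) :: (reg 0 0, reg 2 1) :: zip (regs k 2 0) (regs k 3 1),
        reg 0 1 :: (Some (1, 0), 1) :: regs k 2 0))) => //=.
- by rewrite !inE eqxx orbT.
- by split=> //; split=> //; apply/callg; exists [tuple of [:: i, h & w]], y.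
- rewrite /holds /= -/(holds _ _) holds_zip ?size_regs //.
  by rewrite !eval_regs /= ?size_tuple // !drop0 /eval /= !addn0 !eqxx.
by rewrite eval_regs /= ?size_tuple // drop0 /eval /= addn1 addn0.
Qed.

Lemma mu_systemP k (f : recfun k.+1) sf :
  realizes sf f -> realizes (mu_system k sf) (RMu f).
Proof.
move=> sfP v.
have callf := @derives_Call _ (mu_family sf) _ _ _ f tt _ sfP.
have auxP u : derives (@clauses (mu_system k sf)) (Aux (mu_family sf)) u <->
    exists (w : k.-tuple nat) y, u = y :: w /\
      forall i, i < y -> exists z, computes f [tuple of i :: w] z.+1.
  split.
    move Eq: (Aux _) => q Dq.
    elim: Dq Eq => {q u} q r vs qr szvs qvs IH hvs Eq; subst q.
    move: qr; rewrite !inE => /orP[]/eqP Er; subst r.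
      rewrite /= size_nseq in szvs qvs.
      have /derives_nums[w Ew]: forall j, j < k ->
          derives (@clauses (mu_system k sf)) (Numeral _) (nth [::] vs j).
        by move=> j lt_j; have := qvs j lt_j; rewrite nth_nseq lt_j.
      by exists w, 0; rewrite /= (eval_nums Ew).
    case: vs szvs qvs IH hvs => [|v1 [|v2 [|v3 []]]] //= _ qvs IH hvs.
    have [w [y [/= Ev lty]]] := IH 0 isT erefl; subst v1.
    have /= /callf[w' [z [Ev fz]]] := qvs 1 isT; subst v2.
    have /= /derives_Num[a Ea] := qvs 2 isT; subst v3.
    move: w' fz hvs {IH qvs}; case/tupleP=> i w'.
    rewrite /holds /= -/(holds _ _) holds_zip ?size_regs //.
    rewrite !eval_regs /= ?size_tuple // !drop0 /eval /= !addn0 !addn1.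
    move=> fz /and3P[/eqP Ei /eqP Ez /eqP/val_inj Ew]; subst.
    exists w', i.+1; split=> // j; rewrite ltnS leq_eqVlt => /orP[/eqP->|/lty//].
    by exists a.
  case=> w [y [-> {u}]]; elim: y => [|y IHy] lty.
    pose vs := [seq [:: a] | a <- w].
    have Ew j : j < k -> nth [::] vs j = [:: nth 0 w j].
      by move=> lt_j; rewrite (nth_map 0) ?size_tuple.
    apply: (derivesI (vs := vs)
      (r := (nseq k (Numeral _), [::], cst 0 :: nums k))) => //=.
    - by rewrite inE eqxx.
    - apply/(derives_allP _ (Numeral _)); rewrite size_nseq size_map size_tuple.
      split=> // j lt_j; rewrite nth_nseq lt_j; move: j lt_j.
      by apply/derives_nums; exists w.
    by rewrite (eval_nums Ew).
  have [z fz] := lty y (leqnn _).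
  have {}/IHy auxy: forall i, i < y -> exists z, computes f [tuple of i :: w] z.+1.
    by move=> i /ltnW; apply: lty.
  (* The numeral [z] certifies that the value [z.+1] of [f] is positive. *)
  apply: (derivesI (vs := [:: y :: w; [:: z.+1, y & w]; [:: z]])
    (r := ([:: Aux _; Call _ tt; Numeral _],
         (reg 0 0, reg 1 1) :: (reg 0 1, (Some (0, 2), 1)) ::
           zip (regs k 1 0) (regs k 2 1),
         (Some (0, 0), 1) :: regs k 1 0))) => //=.
  - by rewrite !inE eqxx orbT.
  - split=> //; split; last by split=> //; apply/derives_Num; exists z.
    by apply/callf; exists [tuple of y :: w], z.+1.
  - rewrite /holds /= -/(holds _ _) holds_zip ?size_regs //.
    by rewrite !eval_regs /= ?size_tuple // !drop0 /eval /= !addn0 !addn1 !eqxx.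
  by rewrite eval_regs /= ?size_tuple // drop0 /eval /= addn1.
split.
  move=> /derivesE[r [vs [/= ]]]; rewrite inE => /eqP-> /=.
  case: vs => [|v1 [|v2 [|v3 vs]]] //=; [by case| |by case=> _ [_ []]].
  case=> /auxP[w [y [-> lty]]] [/callf[w' [z [-> fz]]] _].
  move: w' fz; case/tupleP=> i w'.
  rewrite /holds /= -/(holds _ _) holds_zip ?size_regs //.
  rewrite !eval_regs /= ?size_tuple // !drop0 /eval /= !addn0.
  move=> fz /and3P[/eqP Ei /eqP Ez /eqP/val_inj Ew] ->; subst.
  by exists w', i.
case=> w [y [-> [fy lty]]].
apply: (derivesI (vs := [:: y :: w; [:: 0, y & w]])
  (r := ([:: Aux _; Call _ tt],
         (reg 0 0, reg 1 1) :: (reg 0 1, cst 0) :: zip (regs k 1 0) (regs k 2 1),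
         reg 0 0 :: regs k 1 0))) => //=.
- by rewrite !inE eqxx.
- split; first by apply/auxP; exists w, y.
  by split=> //; apply/callf; exists [tuple of y :: w], 0.
- rewrite /holds /= -/(holds _ _) holds_zip ?size_regs //.
  by rewrite !eval_regs /= ?size_tuple // !drop0 /eval /= !addn0 !eqxx.
by rewrite eval_regs /= ?size_tuple // drop0 /eval /= addn0.
Qed.

Lemma comp_systemP m k (f : recfun m) (g : 'I_m -> recfun k) sf sg :
  realizes sf f -> (forall i, realizes (sg i) (g i)) ->
  realizes (comp_system k sf sg) (RComp f g).
Proof.
move=> sfP sgP v; pose rl := @clauses (comp_system k sf sg).
pose F := comp_family sf sg.
have callf := @derives_Call _ (comp_family sf sg) _ _ _ f None _ sfP.
have callg i := @derives_Call _ (comp_family sf sg) _ _ _ (g i) (Some i) _ (sgP i).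
set qs := nseq k (Numeral F) ++ [seq Call F (Some i) | i <- enum 'I_m] ++
  [:: Call F None].
have szqs : size qs = k + m.+1.
  by rewrite !size_cat size_nseq size_map size_enum_ord addn1.
have qsP vs : derives_all rl qs vs <->
    [/\ size vs = k + m.+1,
        forall j, j < k -> derives rl (Numeral F) (nth [::] vs j),
        forall i : 'I_m, derives rl (Call F (Some i)) (nth [::] vs (k + i))
      & derives rl (Call F None) (nth [::] vs (k + m))].
  have nth_num j : j < k -> nth (Numeral F) qs j = Numeral F.
    by move=> lt_j; rewrite nth_cat size_nseq lt_j nth_nseq lt_j.
  have nth_g (i : 'I_m) : nth (Numeral F) qs (k + i) = Call F (Some i).
    rewrite nth_cat size_nseq ltnNge leq_addr addKn nth_cat size_map.
    by rewrite size_enum_ord ltn_ord (nth_map i) ?size_enum_ord // nth_ord_enum.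
  have nth_f : nth (Numeral F) qs (k + m) = Call F None.
    rewrite nth_cat size_nseq ltnNge leq_addr addKn nth_cat size_map.
    by rewrite size_enum_ord ltnn subnn.
  rewrite (derives_allP _ (Numeral F)) szqs.
  split=> [[szvs Dvs]|[szvs Dnum Dg Df]].
    split=> // [j lt_j|i|].
    - by rewrite -[X in derives _ X](nth_num j) //; apply: Dvs; apply: ltn_addr.
    - by rewrite -nth_g; apply: Dvs; rewrite ltn_add2l ltnW // ltnS.
    - by rewrite -nth_f; apply: Dvs; rewrite ltn_add2l.
  split=> // j lt_j; have [lt_jk|le_kj] := ltnP j k.
    by rewrite nth_num //; apply: Dnum.
  rewrite -(subnKC le_kj); have: j - k <= m by rewrite leq_subLR -ltnS -addnS.
  rewrite leq_eqVlt => /orP[/eqP->|lt_i]; first by rewrite nth_f.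
  by rewrite (nth_g (Ordinal lt_i)); apply: (Dg (Ordinal lt_i)).
have allF (T : Type) (a : pred T) ss : all a (flatten ss) = all (all a) ss.
  by elim: ss => //= s ss <-; rewrite all_cat.
set gs := flatten [seq zip (regs k 1 (k + i)) (nums k) | i <- iota 0 m] ++
  zip [seq reg 0 (k + i) | i <- iota 0 m] (regs m 1 (k + m)).
(* [wy i] consists of the arguments and the result of the [i]-th inner call. *)
have gsP vs (w : k.-tuple nat) (u : m.-tuple nat) z
    (wy : 'I_m -> k.-tuple nat * nat) :
    (forall j, j < k -> nth [::] vs j = [:: nth 0 w j]) ->
    (forall i : 'I_m, nth [::] vs (k + i) = (wy i).2 :: (wy i).1) ->
    nth [::] vs (k + m) = z :: u ->
    holds vs gs <-> forall i, wy i = (w, tnth u i).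
  move=> Ew Ewy Eu; rewrite /holds all_cat -!/(holds _ _).
  have -> : holds vs (zip [seq reg 0 (k + i) | i <- iota 0 m] (regs m 1 (k + m))) =
      [forall i, (wy i).2 == tnth u i].
    rewrite holds_zip ?size_map ?size_iota // eval_regs Eu ?size_tuple //= drop0.
    have -> : [seq eval vs i | i <- [seq reg 0 (k + i) | i <- iota 0 m]] =
        [tuple (wy i).2 | i < m].
      rewrite -map_comp -val_enum_ord -map_comp; apply: eq_map => i /=.
      by rewrite /eval /= addn0 Ewy.
    apply/eqP/forallP => [/val_inj <- i|Ei]; first by rewrite tnth_mktuple.
    by congr val; apply: eq_from_tnth => i; rewrite tnth_mktuple; apply/eqP.
  have -> : holds vs (flatten [seq zip (regs k 1 (k + i)) (nums k) | i <- iota 0 m]) =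
      [forall i, (wy i).1 == w].
    rewrite /holds allF all_map -val_enum_ord all_map.
    apply/allP/forallP => [Ei i|Ei i _] /=.
      have := Ei i (mem_enum _ _); rewrite /= -/(holds _ _) holds_zip ?size_regs ?size_nums //.
      by rewrite eval_regs Ewy /= ?size_tuple // drop0 (eval_nums Ew).
    rewrite -/(holds _ _) holds_zip ?size_regs ?size_nums //.
    rewrite eval_regs Ewy /= ?size_tuple // drop0 (eval_nums Ew).
    by rewrite (eqP (Ei i)).
  split=> [/andP[/forallP E1 /forallP E2] i|E].
    by rewrite [LHS]surjective_pairing (eqP (E1 i)) (eqP (E2 i)).
  by apply/andP; split; apply/forallP => i; rewrite E.
split.
  move=> /derivesE[r [vs [/= ]]]; rewrite inE => /eqP-> /=.
  move=> /qsP[szvs /derives_nums[w Ew] Dg /callf[u [z [Eu fz]]]].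
  have /fin_all_exists[wy Ewy] (i : 'I_m) : exists wy : k.-tuple nat * nat,
      nth [::] vs (k + i) = wy.2 :: wy.1 /\ computes (g i) wy.1 wy.2.
    by have /callg[w' [y [Ei gy]]] := Dg i; exists (w', y).
  move=> /(gsP _ _ _ _ _ Ew (fun i => (Ewy i).1) Eu) Egs ->.
  exists w, z; rewrite (eval_nums Ew) /eval /= addn0 Eu; split=> //.
  by exists u => // i; have [_] := Ewy i; rewrite Egs.
case=> w [z [-> [u gu fz]]].
pose vs := [seq [:: a] | a <- w] ++ [seq tnth u i :: w | i <- enum 'I_m] ++ [:: z :: u].
have Ew j : j < k -> nth [::] vs j = [:: nth 0 w j].
  by move=> lt_j; rewrite nth_cat size_map size_tuple lt_j (nth_map 0) ?size_tuple.
have Ewy (i : 'I_m) : nth [::] vs (k + i) = tnth u i :: w.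
  rewrite nth_cat size_map size_tuple ltnNge leq_addr addKn nth_cat size_map.
  by rewrite size_enum_ord ltn_ord (nth_map i) ?size_enum_ord // nth_ord_enum.
have Eu : nth [::] vs (k + m) = z :: u.
  rewrite nth_cat size_map size_tuple ltnNge leq_addr addKn nth_cat size_map.
  by rewrite size_enum_ord ltnn subnn.
apply: (derivesI (vs := vs) (r := (qs, gs, reg 0 (k + m) :: nums k))).
- by rewrite inE.
- apply/qsP; split.
  + by rewrite !size_cat 2!size_map size_enum_ord size_tuple addn1.
  + by apply/derives_nums; exists w.
  + move=> i; rewrite Ewy; apply/callg; exists w, (tnth u i).
    by split=> //; apply: gu.
  + by rewrite Eu; apply/callf; exists u, z.
- by apply/(gsP vs w u z (fun i => (w, tnth u i)) Ew Ewy Eu).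
- by rewrite /= (eval_nums Ew) /eval /= Eu addn0.
Qed.

Lemma compileP k (f : recfun k) : realizes (compile f) f.
Proof.
elim: {k} f => [k||k i|m k f IHf g IHg|k f IHf g IHg|k f IHf] /=.
- by apply: (leaf_systemP (y := fun=> 0)).
- apply: (leaf_systemP (y := fun w => (thead w).+1)) => // w vs Ew.
  by rewrite /eval /= Ew // /thead (tnth_nth 0) addn1.
- apply: (leaf_systemP (y := fun w => tnth w i)) => // w vs Ew.
  by rewrite /eval /= Ew // (tnth_nth 0) addn0.
- by apply: comp_systemP.
- by apply: rec_systemP.
- by apply: mu_systemP.
Qed.

(** * Testing equality with polynomials *)

(* A zero test for [n <= N]: [p.[n]] vanishes for [0 < n <= N] but not for
   [n = 0]; negative arguments are included for the sake of the shift in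
   [separates_shift]. *)
Definition separates (N : nat) (p : {poly rat}) : Prop :=
  (forall a : nat, p.[- a%:R] != 0)%R /\
  (forall a : nat, (0 < a <= N)%N -> p.[a%:R] = 0)%R.

Lemma separates1 : separates 0 1%R.
Proof.
by split=> [a|[|a]] //; rewrite hornerC oner_neq0.
Qed.

(** The value at [a.+1] is [p.[a] * a], where the new factor provides the root 1; the value at [- a]
    involves [p] at [- a.+1], still a negative argument. *)
Lemma separates_shift N p :
  separates N p -> separates N.+1 ((p \Po ('X - 1)) * ('X - 1))%R.
Proof.
case=> pneg pN; split=> [a|[//|a] le_aN];
  rewrite hornerM horner_comp !hornerE.
  by rewrite -opprD natr1 mulf_neq0 // oppr_eq0 pnatr_eq0.
rewrite -natr1 addrK; case: a le_aN => [|a] le_aN; first by rewrite mulr0.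
by rewrite pN ?mul0r.
Qed.

(** Hence a product of polynomials separating several numbers separates each of them. *)
Lemma separates_mull N p q :
  (forall a : nat, q.[- a%:R] != 0)%R -> separates N p -> separates N (q * p)%R.
Proof.
move=> qneg [pneg pN]; split=> a; rewrite hornerM; first by rewrite mulf_neq0.
by move=> /pN->; rewrite mulr0.
Qed.

(** Composition with a constant is evaluation. If [a < b], then [b - a] lies between 1 and [b] and
    is a root of [p], and symmetrically; if [a = b], both factors are [p.[0]], which is non zero. *)
Lemma separates_eq (p : {poly rat}) (a b : nat) :
  separates a p -> separates b p ->
  (((p \Po (a%:R - b%:R)) * (p \Po (b%:R - a%:R)))%R != 0%R) = (a == b).
Proof.
have CE (x y : nat) : (p \Po (x%:R - y%:R) = (p.[x%:R - y%:R])%:P)%R.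
  by rewrite -!(rmorph_nat polyC) -rmorphB comp_polyCr.
move=> [pneg pa] [_ pb]; rewrite !CE -rmorphM polyC_eq0 /=.
case: (ltngtP a b) => [lt_ab|lt_ba|->].
- rewrite -(natrB _ (ltnW lt_ab)) (pb (b - a)) ?mulr0 ?eqxx //.
  by rewrite subn_gt0 lt_ab leq_subr.
- rewrite -(natrB _ (ltnW lt_ba)) (pa (a - b)) ?mul0r ?eqxx //.
  by rewrite subn_gt0 lt_ba leq_subr.
by rewrite subrr; have := pneg 0; rewrite oppr0 => p0; rewrite mulf_neq0.
Qed.

Section Terms.

Variables n k : nat.

(* Register 0 holds a polynomial separating 0 from the stored numbers, and
   register 1 is non zero as long as all the tests have been passed. *)
Definition sep_reg : 'I_n.+2 := ord0.
Definition valid_reg : 'I_n.+2 := lift ord0 ord0.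
Definition value_reg (i : 'I_n) : 'I_n.+2 := lift ord0 (lift ord0 i).

Local Notation term := (pterm ('I_n.+2 * 'I_k)).

(** The constant is added in unary, so that the code of the term is obtained by iterating a
    computable function. [sep_term] follows the same iteration with the shift of
    [separates_shift]. *)
Definition expr_term (e : expr) : term :=
  iter e.2 (fun t => PAdd t (PConst 1%R))
    (if e.1 is Some (i, j) then
       if (insub i, insub j) is (Some i', Some j') then PVar (value_reg i', j')
       else PConst 0%R
     else PConst 0%R).

Definition sep_term (e : expr) : term :=
  iter e.2 (fun t => PMul (PSubs t (PConst ('X - 1)%R)) (PConst ('X - 1)%R))
    (if e.1 is Some (i, j) then
       if insub j is Some j' then PVar (sep_reg, j') else PConst 1%R
     else PConst 1%R).

Definition exprs (T : eqType) (r : clause T) : seq expr :=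
  upd r ++ map fst (guards r) ++ map snd (guards r).

(** The same product is the new separating register and the polynomial used in the tests, so [exprs]
    lists both the updates and the two sides of the guards. *)
Definition clause_sep_term (T : eqType) (r : clause T) : term :=
  foldr (fun e => PMul (sep_term e)) (PConst 1%R) (exprs r).

Definition diff_term (e1 e2 : expr) : term :=
  PAdd (expr_term e1) (PMul (PConst (-1)%R) (expr_term e2)).

(** With [b] equal to [false], the rule is a variant that resets validity to 0. *)
Definition valid_term (T : eqType) (b : bool) (r : clause T) : term :=
  foldr (@PMul _) (PConst b%:R%R)
    ([seq PVar (valid_reg, j) | j <- enum 'I_k] ++
     [seq PMul (PSubs (clause_sep_term r) (diff_term g.1 g.2))
               (PSubs (clause_sep_term r) (diff_term g.2 g.1))
     | g <- guards r]).

(** Positions past the end of [v] count as 0, so that the last condition keeps the separator non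
    zero at non positive integers even when [v] is empty. *)
Definition represents (w : {ffun 'I_n.+2 -> {poly rat}}) (v : seq nat) : Prop :=
  [/\ size v <= n,
      forall i : 'I_n, w (value_reg i) = (nth 0 v i)%:R%R
    & forall i, separates (nth 0 v i) (w sep_reg)].

Section Eval.

Variables (ws : 'I_k -> {ffun 'I_n.+2 -> {poly rat}}) (vs : seq (seq nat)).
Hypothesis size_vs : size vs = k.
Hypothesis wsP : forall j : 'I_k, represents (ws j) (nth [::] vs j).

Let rho (ij : 'I_n.+2 * 'I_k) := ws ij.2 ij.1.

Lemma expr_termP e : peval rho (expr_term e) = (eval vs e)%:R%R.
Proof.
case: e => o c; rewrite /expr_term /eval /= natrD.
elim: c => [|c IHc]; last by rewrite /= IHc -addrA natr1.
rewrite addr0; case: o => [[i j]|] //=.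
case: (insubP 'I_k j) => [j' _ Ej|]; last first.
  by rewrite -leqNgt => le_kj; case: insubP => //=; rewrite [nth [::] _ _]nth_default ?nth_nil ?size_vs.
have [szv vE _] := wsP j'; rewrite -Ej.
case: insubP => [i' _ <-|]; first by rewrite -vE.
by rewrite -leqNgt => le_ni; rewrite nth_default // (leq_trans szv).
Qed.

Lemma sep_termP e : separates (eval vs e) (peval rho (sep_term e)).
Proof.
case: e => o c; rewrite /sep_term /eval /=.
elim: c => [|c IHc]; last by rewrite addnS; apply: separates_shift IHc.
rewrite addn0; case: o => [[i j]|] /=; last exact: separates1.
case: insubP => [j' _ <-|]; first by case: (wsP j') => _ _; apply.
rewrite -leqNgt => le_kj; rewrite [nth [::] _ _]nth_default ?size_vs //.
by rewrite nth_nil; apply: separates1.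
Qed.

Lemma foldr_sep_term_neq0 s (a : nat) :
  (peval rho (foldr (fun e => PMul (sep_term e)) (PConst 1%R) s)).[- a%:R]%R != 0%R.
Proof.
elim: s => [|e s IHs] /=; first by rewrite hornerC oner_neq0.
by rewrite hornerM mulf_neq0 //; have [] := sep_termP e.
Qed.

(** The factor of [e] has the required roots, and the other factors do not vanish at non positive
    integers. *)
Lemma clause_sep_termP (T : eqType) (r : clause T) e : e \in exprs r ->
  separates (eval vs e) (peval rho (clause_sep_term r)).
Proof.
rewrite /clause_sep_term; elim: (exprs r) => //= e' s IHs.
rewrite inE => /orP[/eqP->|/IHs]; last first.
  by apply: separates_mull; have [] := sep_termP e'.
by rewrite mulrC; apply: separates_mull (sep_termP e'); apply: foldr_sep_term_neq0.
Qed.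

Lemma peval_foldr_mul (t : term) ts :
  (peval rho (foldr (@PMul _) t ts) != 0%R) =
  (peval rho t != 0%R) && all (fun t => peval rho t != 0%R) ts.
Proof.
elim: ts => [|t' ts IHts] /=; first by rewrite andbT.
by rewrite mulf_eq0 negb_or IHts andbCA.
Qed.

(** Polynomials over the rationals form an integral domain, so a product acts as a conjunction;
    [separates_eq] applies to each guard because [clause_sep_term] separates both of its sides. *)
Lemma valid_termP (T : eqType) b (r : clause T) :
  (peval rho (valid_term b r) != 0%R) =
  [&& b, [forall j, ws j valid_reg != 0%R] & holds vs (guards r)].
Proof.
rewrite peval_foldr_mul all_cat; congr [&& _, _ & _].
- by case: b; rewrite /= ?oner_eq0 ?eqxx.
- rewrite all_map; apply/allP/forallP => [Ew j|Ew j _]; last exact: Ew.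
  by apply: (Ew j); rewrite mem_enum.
rewrite all_map; apply: eq_in_all => -[e1 e2] gr /=; rewrite !mulN1r !expr_termP.
by rewrite separates_eq //; apply: clause_sep_termP; rewrite !mem_cat;
  apply/or3P; [apply: Or32|apply: Or33]; apply/mapP; exists (e1, e2).
Qed.

End Eval.

End Terms.

(** * The automaton checking derivations *)

Lemma In_map (T : eqType) (U : Type) (f : T -> U) (s : seq T) y :
  List.In y (map f s) <-> exists2 x, x \in s & y = f x.
Proof.
elim: s => [|x s IHs] /=; first by split=> // -[].
rewrite IHs; split=> [[<-|[x' sx' ->]]|[x']]; last 1 first.
- by rewrite inE => /orP[/eqP->|sx'] ->; [left | right; exists x'].
- by exists x; rewrite ?mem_head.
- by exists x'; rewrite // inE sx' orbT.
Qed.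

(* A clause with its target state; the booleans list the factors of the
   validity register, one rule of the automaton for each. *)
Definition transition (T : eqType) : eqType := (seq bool * (T * clause T))%type.

Definition flags (T : eqType) (x : transition T) : seq bool := x.1.
Definition target (T : eqType) (x : transition T) : T := x.2.1.
Definition body (T : eqType) (x : transition T) : clause T := x.2.2.

Section Automaton.

Variables (T : finType) (goal : T) (n : nat).

Definition clause_rule k (q : T) (r : clause T) (b : bool) : rule n.+2 #|T| k :=
  Rule [tuple enum_rank (nth q (src r) j) | j < k] (enum_rank q)
    [tuple of clause_sep_term n k r :: valid_term n k b r ::
       [tuple expr_term n k (nth (cst 0) (upd r) i) | i < n]].

Definition no_transition : transition T := ([::], (goal, ([::], [::], [::]))).

(** Symbols are positions in [L]: the input tree prescribes the clause at each node, and the rules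
    of a symbol differ by their flag only. The signature is a separate argument so that automata for
    different lists can share it. *)
Definition clause_automaton (Sg : signature) (L : seq (transition T)) :
    automaton Sg :=
  @Automaton Sg n.+2 #|T|
    (fun a => let x := nth no_transition L a in
       [seq clause_rule (rank a) (target x) (body x) b | b <- flags x])
    [tuple if q == enum_rank goal then Some (PVar (valid_reg n)) else None
    | q < #|T|].

Definition clauses_of (L : seq (transition T)) (q : T) : seq (clause T) :=
  [seq body x | x <- L & target x == q].

Lemma semantics_clause_automaton Sg L (t : tree Sg) p :
  semantics (clause_automaton Sg L) t p <->
  exists2 w, @run Sg (clause_automaton Sg L) t (enum_rank goal) w &
    p = w (valid_reg n).
Proof.
split=> [[q [w [f [tqw]]]]|[w tw ->]]; last first.
  exists (enum_rank goal), w, (PVar (valid_reg n)).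
  by rewrite tnth_mktuple eqxx.
rewrite tnth_mktuple; case: eqP => // Eq [<-] ->.
by exists w; rewrite -?Eq.
Qed.

Variables (Sg : signature) (L : seq (transition T)).

Lemma run_clause_automaton a (ts : 'I_(rank a) -> tree Sg) q w :
  @run Sg (clause_automaton Sg L) (Node ts) q w <->
  let x := nth no_transition L a in
  exists b (ws : 'I_(rank a) -> {ffun 'I_n.+2 -> {poly rat}}),
    let rho ij := ws ij.2 ij.1 in
    [/\ b \in flags x,
        forall j, @run Sg (clause_automaton Sg L) (ts j)
          (enum_rank (nth (target x) (src (body x)) j)) (ws j),
        q = enum_rank (target x)
      & w = [ffun i => peval rho (tnth (rule_upd
              (clause_rule (rank a) (target x) (body x) b)) i)]].
Proof.
split=> /= [[r [ws [/In_map[b xb ->] tsw -> ->]]]|[b [ws [xb tsw -> ->]]]].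
  by exists b, ws; split=> // j; have := tsw j; rewrite tnth_mktuple.
exists (clause_rule (rank a) (target (nth no_transition L a))
         (body (nth no_transition L a)) b), ws; split=> //.
  by apply/In_map; exists b.
by move=> j; rewrite tnth_mktuple.
Qed.

Lemma tnth_clause_rule k q r b :
  let u := rule_upd (clause_rule k q r b) in
  [/\ tnth u (sep_reg n) = clause_sep_term n k r,
      tnth u (valid_reg n) = valid_term n k b r
    & forall i, tnth u (value_reg i) = expr_term n k (nth (cst 0) (upd r) i)].
Proof. by split=> [||i]; rewrite ?tnth0 ?tnthS ?tnth0 ?tnth_mktuple. Qed.

Hypothesis Sg_L : Sg = [seq size (src (body x)) | x <- L].
Hypothesis size_upd : forall x, x \in L -> size (upd (body x)) <= n.

Lemma represents_upd k (x : transition T) b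
    (ws : 'I_k -> {ffun 'I_n.+2 -> {poly rat}}) vs :
  x \in L -> size vs = k ->
  (forall j : 'I_k, represents (ws j) (nth [::] vs j)) ->
  let w := [ffun i => peval (fun ij => ws ij.2 ij.1)
              (tnth (rule_upd (clause_rule k (target x) (body x) b)) i)] in
  represents w (map (eval vs) (upd (body x))) /\
  (w (valid_reg n) != 0%R) =
    [&& b, [forall j, ws j (valid_reg n) != 0%R] & holds vs (guards (body x))].
Proof.
move=> Lx szvs wsP w.
have [u0 u1 uS] := tnth_clause_rule k (target x) (body x) b.
split; last by rewrite ffunE u1 (valid_termP szvs wsP).
have nthE i : nth 0 (map (eval vs) (upd (body x))) i =
    eval vs (nth (cst 0) (upd (body x)) i).
  have [lt_i|le_i] := ltnP i (size (upd (body x))); first exact: nth_map.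
  by rewrite !nth_default ?size_map.
split=> [|i|i]; first by rewrite size_map size_upd.
  by rewrite ffunE uS (expr_termP szvs wsP) nthE.
rewrite ffunE u0 nthE.
have [lt_i|le_i] := ltnP i (size (upd (body x))).
  by apply: (clause_sep_termP szvs wsP); rewrite mem_cat mem_nth.
(* Past the last update the value is 0, which asks for no root. *)
rewrite nth_default //; split=> [a|[|a]] //.
exact: foldr_sep_term_neq0 szvs wsP _ _.
Qed.

Lemma nth_transition (a : symbol Sg) : nth no_transition L a \in L.
Proof. by rewrite mem_nth // -(size_map (fun x => size (src (body x)))) -Sg_L. Qed.

Lemma rank_symbol (a : symbol Sg) :
  rank a = size (src (body (nth no_transition L a))).
Proof.
have : a < size L by rewrite -(size_map (fun x => size (src (body x)))) -Sg_L.
rewrite /rank; move: (nat_of_ord a) => i lt_i.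
by rewrite Sg_L (nth_map no_transition).
Qed.

(** A failed guard does not block a run, so every run represents some numbers; they come from a
    derivation when no factor of the validity register has vanished. *)
Lemma run_sound (t : tree Sg) q w :
  @run Sg (clause_automaton Sg L) t q w ->
  exists2 v, represents w v &
    w (valid_reg n) != 0%R -> derives (clauses_of L) (enum_val q) v.
Proof.
elim: t q w => a ts IHts q w /run_clause_automaton.
set x := nth no_transition L a => -[b [ws [xb tsw -> ->]]].
have Lx : x \in L := nth_transition a.
have Er : rank a = size (src (body x)) := rank_symbol a.
have /fin_all_exists2[v vR vD] j := IHts j _ _ (tsw j).
pose vs := [tuple v j | j < rank a].
have nth_vs j : nth [::] vs (nat_of_ord j) = v j.
  by rewrite -tnth_nth tnth_mktuple.
have wsP j : represents (ws j) (nth [::] vs j).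
  by rewrite nth_vs.
have [wP ->] := represents_upd b Lx (size_tuple vs) wsP.
exists (map (eval vs) (upd (body x))) => // /and3P[_ /forallP ws0 hvs].
rewrite enum_rankK; apply: Derives => //.
- by apply/mapP; exists x; rewrite // mem_filter eqxx.
- by rewrite size_tuple.
move=> j; rewrite -Er => lt_j; have := vD (Ordinal lt_j) (ws0 _).
by rewrite enum_rankK -nth_vs.
Qed.

(** The tree is the derivation itself, each node being labelled by the position of its clause in
    [L]. *)
Lemma run_complete q v :
  (forall x, x \in L -> true \in flags x) ->
  derives (clauses_of L) q v ->
  exists (t : tree Sg) w,
    [/\ @run Sg (clause_automaton Sg L) t (enum_rank q) w, represents w v
      & w (valid_reg n) != 0%R].
Proof.
move=> flagsL; elim=> {q v} q r vs /mapP[x]; rewrite mem_filter.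
move=> /andP[/eqP Eq Lx ->] szvs _ IH hvs; subst q.
have lt_x : index x L < size Sg by rewrite Sg_L size_map index_mem.
pose a : symbol Sg := Ordinal lt_x.
have Ex : nth no_transition L a = x by rewrite nth_index.
have Er : rank a = size (src (body x)) by rewrite rank_symbol Ex.
have /fin_all_exists[ts tsP] (j : 'I_(rank a)) : exists t : tree Sg, exists w,
    [/\ @run Sg (clause_automaton Sg L) t
          (enum_rank (nth (target x) (src (body x)) j)) w,
        represents w (nth [::] vs j) & w (valid_reg n) != 0%R].
  by apply: IH; rewrite -Er.
have /fin_all_exists[ws wsP] := tsP.
have wsR j : represents (ws j) (nth [::] vs j) by have [] := wsP j.
have [wP w1] := represents_upd true Lx (etrans szvs (esym Er)) wsR.
move: wP w1; set w := [ffun _ => _] => wP w1.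
exists (Node ts), w; split=> //.
  apply/run_clause_automaton; rewrite Ex /=; exists true, ws; split=> //.
    exact: flagsL.
  by move=> j; have [] := wsP j.
by rewrite w1 hvs andbT; apply/forallP => j; have [] := wsP j.
Qed.

(** Changing the rule at the root is enough: its flag [false] annihilates the validity register
    whatever the subtrees give. *)
Lemma run_zero (t : tree Sg) q w :
  (forall x, x \in L -> target x = enum_val q -> false \in flags x) ->
  @run Sg (clause_automaton Sg L) t q w ->
  exists2 w', @run Sg (clause_automaton Sg L) t q w' & w' (valid_reg n) = 0%R.
Proof.
case: t => a ts flagsL /run_clause_automaton[b [ws [_ tsw Eq _]]].
have La := nth_transition a.
eexists.
  apply/run_clause_automaton; exists false, ws; split=> //.
  by apply: flagsL; rewrite // Eq enum_rankK.
rewrite ffunE; have [_ -> _] := tnth_clause_rule (rank a)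
  (target (nth no_transition L a)) (body (nth no_transition L a)) false.
rewrite /valid_term; elim: (_ ++ _) => //= ? ? ->.
by rewrite mulr0.
Qed.

Lemma run_false (t : tree Sg) q w :
  (forall x, x \in L -> target x = enum_val q -> true \notin flags x) ->
  @run Sg (clause_automaton Sg L) t q w -> w (valid_reg n) = 0%R.
Proof.
case: t => a ts flagsL /run_clause_automaton[b [ws [xb tsw Eq ->]]].
have La := nth_transition a.
case: b xb => xb; first by have := flagsL _ La; rewrite Eq enum_rankK xb => /(_ erefl).
rewrite ffunE; have [_ -> _] := tnth_clause_rule (rank a)
  (target (nth no_transition L a)) (body (nth no_transition L a)) false.
rewrite /valid_term; elim: (_ ++ _) => //= ? ? ->.
by rewrite mulr0.
Qed.

(** With at most one flag per symbol, the label of a node determines the rule applied there. *)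
Lemma run_inj (t : tree Sg) q q' w w' :
  (forall x, x \in L -> size (flags x) <= 1) ->
  @run Sg (clause_automaton Sg L) t q w ->
  @run Sg (clause_automaton Sg L) t q' w' -> w = w'.
Proof.
move=> flagsL; elim: t q q' w w' => a ts IHts q q' w w'.
move=> /run_clause_automaton[b [ws [xb tsw _ ->]]].
move=> /run_clause_automaton[b' [ws' [xb' tsw' _ ->]]].
have Ews j : ws j = ws' j := IHts j _ _ _ _ (tsw j) (tsw' j).
have Eb : b = b'.
  move: xb xb'; have := flagsL _ (nth_transition a).
  by case: flags => [|c []] //= _; rewrite !inE => /eqP-> /eqP->.
apply/ffunP => i; rewrite !ffunE Eb.
elim: (tnth _ _) => //= [[i' j]|s -> t ->|s -> t ->|s -> t ->] //.
by rewrite Ews.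
Qed.

End Automaton.

(** Rules put no condition on registers, so the existence of a run depends only on the states and on
    every symbol having a rule. *)
Lemma run_skeleton (T : finType) (goal : T) n Sg (L L' : seq (transition T)) :
  let skeleton x := (target x, src (body x)) in
  map skeleton L = map skeleton L' ->
  (forall x, x \in L' -> flags x != [::]) ->
  forall (t : tree Sg) q w, @run Sg (clause_automaton goal n Sg L) t q w ->
  exists w', @run Sg (clause_automaton goal n Sg L') t q w'.
Proof.
move=> skeleton EL flagsL'; elim=> a ts IHts q w.
move=> /run_clause_automaton[b [ws [xb tsw Eq _]]].
(* Beyond [L], the default [no_transition] has no flag, hence no rule. *)
have lt_a : a < size L.
  rewrite ltnNge; apply: contraL xb => le_a.
  by rewrite nth_default.
have lt_a' : a < size L' by rewrite -(size_map skeleton) -EL size_map.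
have Ea : skeleton (nth (no_transition goal) L a) =
    skeleton (nth (no_transition goal) L' a).
  by rewrite -!(nth_map _ (skeleton (no_transition goal))) // EL.
move: Ea tsw Eq => [-> ->] tsw Eq.
have := flagsL' _ (mem_nth (no_transition goal) lt_a').
case Eflags: flags => [|b' bs] // _.
have /fin_all_exists[ws' tsw'] j := IHts j _ _ (tsw j).
eexists; apply/run_clause_automaton; exists b', ws'; split=> //.
by rewrite Eflags mem_head.
Qed.

(** * Self-reference *)

Definition const_code (c : {poly rat}) : nat := code_seq [:: 1; code_poly c].

(** The codes of [expr_term] and, in [sep_code], of [sep_term] at the constant [c]; 2, 3 and 4 are
    the tags of [PAdd], [PMul] and [PSubs]. *)
Definition value_code (c : nat) : nat :=
  iter c (fun x => code_seq [:: 2; x; const_code 1%R]) (const_code 0%R).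

Definition sep_code (c : nat) : nat :=
  iter c (fun x => code_seq [:: 3; code_seq [:: 4; x; const_code ('X - 1)%R];
                                const_code ('X - 1)%R]) (const_code 1%R).

(** The entry [const_code 1] stands for the validity register of a rule without children or guards;
    [u] lists the codes for the value registers left over by [p]. *)
Definition input_rule_code (q : nat) (p u : seq nat) : nat :=
  code_seq [:: code_seq [::]; q;
    code_seq (foldr (fun c x => code_seq [:: 3; sep_code c; x]) (const_code 1%R) p ::
              const_code 1%R :: map value_code p ++ u)].

(* The code of the automaton [checker p fl] below, [v] listing the codes of the
   parts that do not depend on [p]. *)
Definition template (v p : seq nat) : nat :=
  code_seq [:: nth 0 v 0,
    code_seq [:: nth 0 v 1; nth 0 v 2;
      code_seq (code_seq [:: input_rule_code (nth 0 v 3) p (CodeSeq.decode (nth 0 v 4))]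
                :: CodeSeq.decode (nth 0 v 5));
      nth 0 v 6]
    & CodeSeq.decode (nth 0 v 7)].

(** * The automaton checking that a function has value 1 at [p], and its code *)

Section Checker.

Variables (s : system) (k : nat).

Definition checker_state : finType := option (option (state s)).
Definition goal : checker_state := None.
Definition input : checker_state := Some None.
Definition embed (q : state s) : checker_state := Some (Some q).

Definition input_clause (p : seq nat) : clause checker_state :=
  ([::], [::], map cst p).

Definition goal_clause : clause checker_state :=
  ([:: input; embed (start s)],
   (reg 0 1, cst 1) :: zip (regs k 0 0) (regs k 1 1), [::]).

Definition checker_core : seq (checker_state * clause checker_state) :=
  (goal, goal_clause) ::
  [seq (embed q, clause_map embed r) | q <- enum (state s), r <- clauses q].

(** [p] occurs only in the first transition, whose single flag makes it occur in a single rule of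
    the automaton. *)
Definition checker_list (p : seq nat) (fl : seq bool) :
    seq (transition checker_state) :=
  ([:: true], (input, input_clause p)) :: [seq (fl, x) | x <- checker_core].

Definition checker_width : nat := k + \max_(x <- checker_core) size (upd x.2).

Definition checker_sig : signature :=
  0 :: [seq size (src x.2) | x <- checker_core].

Definition checker (p : seq nat) (fl : seq bool) : automaton checker_sig :=
  clause_automaton goal checker_width checker_sig (checker_list p fl).

Lemma checker_sigE p fl :
  checker_sig = [seq size (src (body x)) | x <- checker_list p fl].
Proof. by rewrite /= -map_comp. Qed.

Lemma checker_widthP p fl x : size p <= k ->
  x \in checker_list p fl -> size (upd (body x)) <= checker_width.
Proof.
rewrite inE => lepk /orP[/eqP->|/mapP[y core_y ->]].
  by rewrite size_map (leq_trans lepk) ?leq_addr.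
apply: leq_trans (leq_addl _ _).
exact: (leq_bigmax_seq (F := fun x : checker_state * clause checker_state => size (upd x.2))).
Qed.

(** [input] derives exactly [p], the embedded start state derives the graph of [f], and the guards
    of the goal clause select the argument [p] and the value 1. *)
Lemma derives_goal (f : recfun k) (p : k.-tuple nat) fl : realizes s f ->
  (exists v, derives (clauses_of (checker_list p fl)) goal v) <->
  computes f p 1.
Proof.
move=> sf; set rl := clauses_of _.
have rlP q r : r \in rl q <-> (q, r) = (input, input_clause p) \/
    (q, r) \in checker_core.
  split=> [/mapP[x]|].
    rewrite mem_filter inE => /andP[/eqP <-] /orP[/eqP-> ->|/mapP[y core_y -> ->]].
      by left.
    by right; rewrite -surjective_pairing.
  case=> [[-> ->]|core_qr]; apply/mapP.
    by exists ([:: true], (input, input_clause p)); rewrite ?mem_filter ?mem_head //= eqxx.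
  exists (fl, (q, r)) => //; rewrite mem_filter eqxx in_cons.
  by rewrite (map_f (pair fl) core_qr) orbT.
have embedP v : derives rl (embed (start s)) v <->
    exists (w : k.-tuple nat) y, v = y :: w /\ computes f w y.
  rewrite -sf; apply: derives_map => q r; apply/idP/idP.
    move/rlP => [[]//|]; rewrite inE => /orP[/eqP[]//|].
    move=> /allpairsPdep[q' [r' [_ qr' [-> ->]]]].
    exact: map_f.
  move=> /mapP[r' qr' ->]; apply/rlP; right; rewrite inE; apply/orP; right.
  by apply/allpairsPdep; exists q, r'; rewrite mem_enum.
have inputP v : derives rl input v <-> v = p :> seq nat.
  have evalp : map (eval [::]) (map cst p) = p.
    by rewrite -map_comp map_id_in // => c _; rewrite /= /eval /=.
  split=> [/derivesE[r [vs [/rlP[[->]|]]]]|->].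
  - by case: vs => //= _ _ ->.
  - by rewrite inE => /orP[/eqP[]//|/allpairsPdep[q' [r' [_ _ []]]]].
  apply: (derivesI (vs := [::]) (r := input_clause p)) => //.
  by apply/rlP; left.
have goalP v : derives rl goal v <-> exists2 vs, derives_all rl (src goal_clause) vs
    & holds vs (guards goal_clause) /\ v = [::].
  rewrite derivesE; split=> [[r [vs [/rlP[[]//|]]]]|[vs Dvs [hvs ->]]].
    rewrite inE => /orP[/eqP[->]|/allpairsPdep[q' [r' [_ _ []]]] //].
    by move=> Dvs hvs ->; exists vs.
  by exists goal_clause, vs; split=> //; apply/rlP; right; rewrite mem_head.
split=> [[v /goalP[vs Dvs [hvs _]]]|fp].
  rewrite /goal_clause /= in Dvs hvs.
  case: vs Dvs hvs => [|v1 [|v2 [|v3 vs]]] //=; last by case=> _ [_ []].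
  case=> /inputP-> [/embedP[w [y [-> fwy]]] _].
  rewrite /holds /= -/(holds _ _) holds_zip ?size_regs //.
  rewrite !eval_regs /= ?size_tuple // !drop0 /eval /= addn0 add0n.
  by move=> /andP[/eqP Ey /eqP/val_inj Ew]; rewrite Ew -Ey.
exists [::]; apply/goalP; exists [:: val p; 1 :: val p].
  by split; [apply/inputP | split=> //; apply/embedP; exists p, 1].
split=> //; rewrite /holds /= -/(holds _ _) holds_zip ?size_regs //.
by rewrite !eval_regs /= ?size_tuple // !drop0 /eval /= !eqxx.
Qed.

Lemma code_input_rule n (p : seq nat) : size p <= n ->
  code_rule (clause_rule n 0 input (input_clause p) true) =
  input_rule_code (enum_rank input) p (nseq (n - size p) (const_code 0%R)).
Proof.
move=> le_pn; rewrite /code_rule /input_rule_code.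
have -> : map (@code_ord #|checker_state|)
    (rule_src (clause_rule n 0 input (input_clause p) true)) = [::].
  by apply: size0nil; rewrite size_map size_tuple.
congr (code_seq [:: _; _; code_seq _]).
have iterE V (cv : V -> nat) (F : pterm V -> pterm V) (f : nat -> nat) t c :
    (forall t, code_pterm cv (F t) = f (code_pterm cv t)) ->
    code_pterm cv (iter c F t) = iter c f (code_pterm cv t).
  by move=> FE; elim: c => //= c <-.
have valueE c : code_pterm (@code_ord2 n.+2 0) (expr_term n 0 (cst c)) = value_code c.
  exact: iterE.
have sepE c : code_pterm (@code_ord2 n.+2 0) (sep_term n 0 (cst c)) = sep_code c.
  exact: iterE.
rewrite /=; congr [:: _, _ & _].
- rewrite /clause_sep_term /exprs /= cats0.
  by elim: p {le_pn} => //= c p ->; rewrite sepE.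
- rewrite /valid_term /= cats0.
  have -> : enum 'I_0 = [::] by apply: size0nil; rewrite size_enum_ord.
  by [].
apply: (@eq_from_nth _ 0) => [|i].
  by rewrite 2!size_map size_enum_ord size_cat size_map size_nseq subnKC.
rewrite 2!size_map size_enum_ord => lt_in.
rewrite -map_comp (nth_map (Ordinal lt_in)) ?size_enum_ord //=.
rewrite nth_enum_ord // nth_cat size_map; case: ltnP => [lt_ip|le_pi].
  by rewrite !(nth_map 0) // valueE.
by rewrite nth_default ?size_map // nth_nseq ltn_sub2r ?(leq_ltn_trans le_pi) // valueE.
Qed.

(** The eight entries read by [template]. They are taken from the checker of the empty list, since
    only the rule of the first symbol depends on [p]. *)
Definition checker_parts (fl : seq bool) (es : seq nat) : seq nat :=
  [:: code_seq checker_sig; checker_width.+2; #|checker_state|;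
      (enum_rank input : nat);
      code_seq (nseq (checker_width - k) (const_code 0%R));
      code_seq [seq code_seq (map (@code_rule _ _ _)
                        (delta (checker [::] fl) (lift ord0 a)))
               | a <- enum 'I_(size (behead checker_sig))];
      code_seq (map (@code_out _) (out (checker [::] fl)));
      code_seq es].

(** [es] leaves room for the code of a second automaton, as in instances of equivalence. *)
Lemma code_checker (p : k.-tuple nat) fl es :
  code_seq [:: code_seq checker_sig, code_automaton (checker p fl) & es] =
  template (checker_parts fl es) p.
Proof.
pose parts := checker_parts fl es; rewrite /template -/parts.
have -> : CodeSeq.decode (nth 0 parts 4) = _ := CodeSeq.codeK _.
have -> : CodeSeq.decode (nth 0 parts 5) = _ := CodeSeq.codeK _.
have -> : CodeSeq.decode (nth 0 parts 7) = _ := CodeSeq.codeK _.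
have lepw : size p <= checker_width by rewrite size_tuple leq_addr.
rewrite -[X in checker_width - X](size_tuple p) -code_input_rule //.
congr (code_seq [:: _, _ & _]).
rewrite /code_automaton.
congr (code_seq [:: _; _; code_seq _; _]).
rewrite enum_ordSl.
apply: (congr2 cons); first by [].
exact: esym (map_comp (fun a => code_seq (map (@code_rule _ _ _) (delta (checker p fl) a))) _ _).
Qed.

End Checker.

(** * Computability of the template *)

Lemma eq_computable k (F G : k.-tuple nat -> nat) :
  F =1 G -> computable F -> computable G.
Proof. by move=> eFG [f fP]; exists f => v; rewrite -eFG. Qed.

Lemma computable_nth k i : computable (fun v : k.-tuple nat => nth 0 v i).
Proof.
have [lt_ik|le_ki] := ltnP i k.
  by apply: eq_computable (computable_proj (Ordinal lt_ik)) => v; rewrite (tnth_nth 0).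
by apply: eq_computable (computable_const k 0) => v; rewrite nth_default ?size_tuple.
Qed.

(** Nothing is actually decoded: coding a decoded number gives it back. *)
Lemma computable_decode k (F : k.-tuple nat -> nat) :
  computable F -> computable (fun v => code_seq (CodeSeq.decode (F v))).
Proof. by apply: eq_computable => v; rewrite CodeSeq.decodeK. Qed.

(** The length [k] is fixed, so the fold unrolls into [k] compositions. *)
Lemma computable_foldr k (h : nat -> nat -> nat) (F : k.-tuple nat -> nat) :
  (forall G H : k.-tuple nat -> nat, computable G -> computable H ->
     computable (fun v => h (G v) (H v))) ->
  computable F -> computable (fun v => foldr h (F v) v).
Proof.
move=> ch cF.
have cfold s : computable (fun v : k.-tuple nat => foldr h (F v) (map (nth 0 v) s)).
  by elim: s => [|i s IHs] //=; apply: ch IHs; apply: computable_nth.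
apply: eq_computable (cfold (iota 0 k)) => v; congr foldr.
by rewrite -[in RHS](mkseq_nth 0 v) size_tuple.
Qed.

(** Expresses the code of the list as a fold on codes, to which [computable_foldr] applies. *)
Lemma code_seq_map_cat (g : nat -> nat) p u :
  code_seq (map g p ++ u) =
  foldr (fun c x => code_seq (g c :: CodeSeq.decode x)) (code_seq u) p.
Proof.
elim: p => [|c p IHp] //.
by rewrite -[RHS]/(code_seq (g c :: CodeSeq.decode (foldr _ _ _))) -IHp CodeSeq.codeK.
Qed.

Lemma computable_template k :
  computable (fun v : k.-tuple nat => template v v).
Proof.
have nil := computable_code_nil; have cons := computable_code_cons.
have cst := computable_const; have nth := @computable_nth k.
have var : computable (fun v : 1.-tuple nat => thead v) := computable_proj ord0.
have value (F : k.-tuple nat -> nat) : computable F ->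
    computable (fun v => value_code (F v)).
  by move=> cF; apply: computable_iter cF (cst _ _); do !apply: (cons).
have sep (F : k.-tuple nat -> nat) : computable F ->
    computable (fun v => sep_code (F v)).
  by move=> cF; apply: computable_iter cF (cst _ _); do !apply: (cons).
have rule : computable (fun v : k.-tuple nat =>
    input_rule_code (seq.nth 0 v 3) v (CodeSeq.decode (seq.nth 0 v 4))).
  apply: (cons) => //; apply: (cons) => //; apply: (cons) => //.
  apply: (cons).
    apply: computable_foldr => // G H cG cH.
    by do !apply: (cons) => //; apply: sep.
  apply: (cons) => //.
  apply: (eq_computable (fun v => esym (code_seq_map_cat _ v _))).
  apply: computable_foldr => [G H cG cH|]; last exact: computable_decode.
  by apply: (cons); [apply: value | apply: computable_decode].
apply: (cons) => //; apply: (cons); last exact: computable_decode.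
apply: (cons) => //; apply: (cons) => //; apply: (cons); last exact: (cons).
apply: (cons); last exact: computable_decode.
exact: (cons).
Qed.

(** The diagonal step, as in Kleene's recursion theorem: once [p] lists the parts of the checker
    built from [G], the value of [G] at [p] is the answer of [f] on the code of that checker. *)
Lemma self_reference (f : recfun 1) :
  exists G : recfun 8, forall v y,
    computes G v y <-> computes f [tuple template v v] y.
Proof.
have [c cP] := computable_template 8; exists (RComp f (fun=> c)) => v y.
split=> [[w cw fw]|fy].
  suff -> : [tuple template v v] = w by [].
  by apply: eq_from_tnth => i; apply: computes_inj (cw i); rewrite (ord1 i).
by exists [tuple template v v] => // i; rewrite (ord1 i).
Qed.

(** * Behaviour of the checker and undecidability *)

Lemma semantics_checker (s : system) k p fl t x :
  semantics (checker s k p fl) t x <->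
  exists2 w, run (M := checker s k p fl) t (enum_rank (goal s)) w &
    x = w (valid_reg (checker_width s k)).
Proof. exact: semantics_clause_automaton. Qed.

Lemma checker_complete (s : system) k (f : recfun k) (p : k.-tuple nat)
    (fl : seq bool) :
  realizes s f -> true \in fl -> computes f p 1 ->
  exists2 t, exists w,
    run (M := checker s k p fl) t (enum_rank (goal s)) w &
    exists2 x, semantics (checker s k p fl) t x & x != 0%R.
Proof.
move=> sf fl1 /(derives_goal p fl sf)[v Dv].
have szL x : x \in checker_list s k p fl -> size (upd (body x)) <= checker_width s k.
  by apply: checker_widthP; rewrite size_tuple.
have flL x : x \in checker_list s k p fl -> true \in flags x.
  by rewrite inE => /orP[/eqP->|/mapP[y _ ->]].
have [t [w [tw _ w0]]] := run_complete (goal s) (checker_sigE s k p fl) szL flL Dv.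
exists t; first by exists w.
exists (w (valid_reg (checker_width s k))) => //; apply/semantics_checker.
by exists w.
Qed.

Lemma checker_sound (s : system) k (f : recfun k) (p : k.-tuple nat) fl t x :
  realizes s f -> ~ computes f p 1 -> semantics (checker s k p fl) t x -> x = 0%R.
Proof.
move=> sf nfp /semantics_checker[w tw ->].
apply/eqP; apply: contra_notT nfp => w0; apply/(derives_goal p fl sf).
have szL y : y \in checker_list s k p fl -> size (upd (body y)) <= checker_width s k.
  by apply: checker_widthP; rewrite size_tuple.
have [v _ /(_ w0)] := run_sound (checker_sigE s k p fl) szL tw.
by rewrite enum_rankK; exists v.
Qed.

Lemma goal_flags (s : system) k p fl x :
  x \in checker_list s k p fl -> target x = goal s -> flags x = fl.
Proof. by rewrite inE => /orP[/eqP->|/mapP[y _ ->]]. Qed.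

Lemma checker_functional (s : system) k p fl :
  size fl <= 1 -> functional (checker s k p fl).
Proof.
move=> szfl t x y /semantics_checker[w tw ->].
move=> /semantics_checker[w' tw' ->].
suff -> : w = w' by [].
apply: (run_inj (checker_sigE s k p fl) _ tw tw') => z.
by rewrite inE => /orP[/eqP->|/mapP[? _ ->]].
Qed.

Lemma checker_domain (s : system) k p p' fl fl' t x : fl' != [::] ->
  semantics (checker s k p fl) t x -> exists y, semantics (checker s k p' fl') t y.
Proof.
move=> fl0 /semantics_checker[w tw _].
have flL' z : z \in checker_list s k p' fl' -> flags z != [::].
  by rewrite inE => /orP[/eqP->|/mapP[? _ ->]].
have eqL : [seq (target z, src (body z)) | z <- checker_list s k p fl] =
    [seq (target z, src (body z)) | z <- checker_list s k p' fl'].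
  by rewrite /= -!map_comp.
have [w' tw'] := run_skeleton eqL flL' tw.
by exists (w' (valid_reg (checker_width s k))); apply/semantics_checker; exists w'.
Qed.

Lemma checker_false (s : system) k p t x :
  semantics (checker s k p [:: false]) t x -> x = 0%R.
Proof.
move=> /semantics_checker[w tw ->].
apply: (run_false (checker_sigE s k p [:: false]) _ tw) => z Lz.
by rewrite enum_rankK => /(goal_flags Lz)->.
Qed.

Lemma undecidable_functionality :
  ~ decidable_problem code_instance
      (fun X : {S : signature & automaton S} => functional (tagged X)).
Proof.
case=> f fP; have [G GP] := self_reference f.
pose s := compile G; have sG : realizes s G := compileP G.
pose fl := [:: true; false].
(* The parts do not mention [p], so the choice is not circular, and [template p p] is the code of
   the automaton that contains [p]. *)
have [p Ep] : exists p : 8.-tuple nat, val p = checker_parts s 8 fl [::].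
  by exists [tuple of checker_parts s 8 fl [::]].
pose M := checker s 8 p fl.
pose X := existT automaton (checker_sig s 8) M.
have EX : code_instance X = template p p.
  by rewrite [X in template X _]Ep -code_checker.
have [fY fN] := fP X Logic.I; rewrite EX in fY fN.
(* If [M] is functional, [f] answers 1, so some tree has a non zero output; by [run_zero] the same
   tree also has output 0. *)
have nfun : ~ functional M.
  move=> Mfun; have /GP/(checker_complete sG (fl := fl) isT) := fY Mfun.
  case=> t [w tw] [x tx /eqP[]].
  have flL z : z \in checker_list s 8 p fl -> target z = enum_val (enum_rank (goal s)) ->
      false \in flags z.
    by rewrite enum_rankK => Lz /(goal_flags Lz)->.
  have [w' tw' w0] := run_zero (checker_sigE s 8 p fl) flL tw.
  apply: (Mfun t) => //; apply/semantics_checker.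
  by exists w'.
(* Now [f] answers 0, so there is no valid derivation: all outputs are 0 and [M] is functional, a
   contradiction. *)
apply: (nfun) => t x y tx ty.
have nG : ~ computes G p 1.
  by move/GP => f1; have := computes_inj f1 (fN nfun).
by rewrite (checker_sound sG nG tx) (checker_sound sG nG ty).
Qed.

Lemma undecidable_equivalence :
  ~ decidable_promise code_pair_instance
      (fun X : {S : signature & (automaton S * automaton S)%type} =>
         functional (tagged X).1 /\ functional (tagged X).2)
      (fun X => equivalent (tagged X).1 (tagged X).2).
Proof.
case=> f fP; have [G GP] := self_reference f.
pose s := compile G; have sG : realizes s G := compileP G.
(* [N] outputs 0 only. Being built from the empty list, it has a code available before [p] is
   chosen. *)
pose N := checker s 8 [::] [:: false].
have [p Ep] : exists p : 8.-tuple nat,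
    val p = checker_parts s 8 [:: true] [:: code_automaton N].
  by exists [tuple of checker_parts s 8 [:: true] [:: code_automaton N]].
pose M := checker s 8 p [:: true].
pose X := existT (fun S => automaton S * automaton S)%type (checker_sig s 8) (M, N).
have EX : code_pair_instance X = template p p.
  by rewrite [X in template X _]Ep -code_checker.
have promiseX : functional M /\ functional N by split; apply: checker_functional.
have [fY fN] := fP X promiseX; rewrite EX in fY fN.
(* If the automata are equivalent, [f] answers 1 and [M] has a non zero output, unlike [N]. *)
have neq : ~ equivalent M N.
  move=> eqMN; have /GP/(checker_complete sG (fl := [:: true]) isT) := fY eqMN.
  by case=> t _ [x /eqMN/checker_false-> /eqP].
(* Now [f] answers 0, so [M] too outputs 0 only, and the two domains agree by [checker_domain]. *)
apply: (neq) => t x.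
have nG : ~ computes G p 1.
  by move/GP => f1; have := computes_inj f1 (fN neq).
split=> [Mx|Nx].
  have [y Ny] := @checker_domain s 8 _ [::] _ [:: false] _ _ isT Mx.
  by rewrite (checker_sound sG nG Mx) -(checker_false Ny).
have [y My] := @checker_domain s 8 _ p _ [:: true] _ _ isT Nx.
by rewrite (checker_false Nx) -(checker_sound sG nG My).
Qed.

Theorem theorem17 :
  ~ decidable_problem code_instance
      (fun X : {S : signature & automaton S} => functional (tagged X)) /\
  ~ decidable_promise code_pair_instance
      (fun X : {S : signature & (automaton S * automaton S)%type} =>
         functional (tagged X).1 /\ functional (tagged X).2)
      (fun X => equivalent (tagged X).1 (tagged X).2).
Proof. exact: conj undecidable_functionality undecidable_equivalence. Qed.
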